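(* Let $\tau:\mathcal A\to\mathcal A^+$ be a substitution satisfying the standing assumptions below which is left proper and quasi-invertible, with fixed point $u$. Then there exists a semi-proper, stationary ordered Bratteli diagram $\mathcal B$ such that $(X_{\mathcal B},V_{\mathcal B})$ is topologically conjugate to $(X_\tau,\sigma)$.
   Context: Substitutions are extended to words and sequences by concatenation; $\tau$ is left proper if some letter is the first letter of every $\tau(a)$. $u$ is a fixed point ($\tau(u)=u$, $u\in\mathcal A^{\mathbb N}$), $\sigma$ is the left shift and $X_\tau$ the closure of $\{\sigma^n(u)\}$. A branch point is a point of $X_\tau$ with more than one $\sigma$-preimage in $X_\tau$; quasi-invertible means exactly one branch point. Standing assumptions: $\tau$ primitive, $X_\tau$ infinite, $\tau$ unilaterally recognizable (with $E=\{0\}\cup\{|\tau(u_0\cdots u_{p-1})|:p>0\}$ there is $L$ with $u_{[i,i+L-1]}=u_{[j,j+L-1]}$, $i\in E$ implying $j\in E$), all powers of $\tau$ injective on letters. An ordered Bratteli diagram has finite vertex sets $V_0=\{v_0\},V_1,\ldots$, finite edge sets $E_n$ ($n\ge1$) with source $s:E_n\to V_{n-1}$ and range $r:E_n\to V_n$ (every vertex a source, every vertex but $v_0$ a range), and a linear order on $r^{-1}(a)$ for every vertex $a\neq v_0$. It is stationary if there is a substitution $\theta$ on an alphabet $V$ with $V_n=V$ for $n\ge1$ and, for $n\ge2$, the edges with range $a$, in increasing order, have as sources the successive letters of $\theta(a)$ ($E_1$ and its order may be arbitrary). $X_{\mathcal B}$ is the space of infinite paths $(x_n)$, $x_n\in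 E_n$, $s(x_{n+1})=r(x_n)$, with the product topology; maximal/minimal paths consist of maximal/minimal edges. $\mathcal B$ is simple if some power of the incidence matrix of $\theta$ is positive. For non-maximal $x$, with $k$ least such that $x_k$ is not maximal and $y_k$ the successor of $x_k$, $V_{\mathcal B}(x)=(z_1,\ldots,z_{k-1},y_k,x_{k+1},\ldots)$ where $z_1\cdots z_{k-1}$ is the minimal path from $v_0$ to $s(y_k)$. $\mathcal B$ is semi-proper if it is simple and has a unique minimal path $m$; then $V_{\mathcal B}$ is extended to all of $X_{\mathcal B}$ by sending every maximal path to $m$. *)

(* Defs.v *)
From mathcomp Require Import all_boot.
From Stdlib Require Import ClassicalEpsilon.

Set Implicit Arguments.
Unset Strict Implicit.
Unset Printing Implicit Defensive.

Definition shift {T : Type} (x : nat -> T) : nat -> T := fun n => x n.+1.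

(* Continuity of f restricted to D, for the product topology on
   sequence spaces with discrete factors (basic opens = cylinders). *)
Definition cont_on {T1 T2 : Type} (D : (nat -> T1) -> Prop)
  (f : (nat -> T1) -> (nat -> T2)) : Prop :=
  forall x, D x -> forall n, exists m, forall y, D y ->
    (forall i, i < m -> y i = x i) -> forall i, i < n -> f y i = f x i.

Definition top_conj {T1 T2 : Type}
  (X1 : (nat -> T1) -> Prop) (f1 : (nat -> T1) -> (nat -> T1))
  (X2 : (nat -> T2) -> Prop) (f2 : (nat -> T2) -> (nat -> T2)) : Prop :=
  exists (h : (nat -> T1) -> (nat -> T2)) (g : (nat -> T2) -> (nat -> T1)),
    (forall x, X1 x -> X2 (h x)) /\
    (forall y, X2 y -> X1 (g y)) /\
    (forall x, X1 x -> g (h x) = x) /\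
    (forall y, X2 y -> h (g y) = y) /\
    cont_on X1 h /\ cont_on X2 g /\
    (forall x, X1 x -> h (f1 x) = f2 (h x)).

Section Subst.
Variable A : finType.
Variable tau : A -> seq A.

Definition tauw (w : seq A) : seq A := flatten (map tau w).

Definition iterw (k : nat) (w : seq A) : seq A := iter k tauw w.

Fixpoint incpow (k : nat) (a b : A) : nat :=
  match k with
  | 0 => (a == b : nat)
  | k'.+1 => \sum_(c : A) incpow k' a c * count_mem b (tau c)
  end.

Definition primitive : Prop :=
  exists k, 0 < k /\ forall a b, 0 < incpow k a b.

Definition prefix (u : nat -> A) (p : nat) : seq A := mkseq u p.

(* tau(u) = u for u in A^N: tau(u_0...u_{p-1}) is a prefix of u for all p
   (equivalent to tau(u)=u since tau is non-erasing) *)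
Definition fixed_point (u : nat -> A) : Prop :=
  forall p i, i < size (tauw (prefix u p)) ->
    nth (u 0) (tauw (prefix u p)) i = u i.

(* X_tau = closure of the shift-orbit of u in A^N (product topology) *)
Definition Xtau (u : nat -> A) (x : nat -> A) : Prop :=
  forall n, exists m, forall i, i < n -> x i = u (m + i).

Definition infinite_set {T : Type} (X : T -> Prop) : Prop :=
  ~ exists (n : nat) (f : 'I_n -> T), forall x, X x -> exists i, x = f i.

Definition inE (u : nat -> A) (i : nat) : Prop :=
  exists p, i = size (tauw (prefix u p)).

Definition unilaterally_recognizable (u : nat -> A) : Prop :=
  exists L, forall i j, inE u i ->
    (forall k, k < L -> u (i + k) = u (j + k)) -> inE u j.

Definition left_proper : Prop :=
  exists b : A, forall a, exists w, tau a = b :: w.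

End Subst.

Definition branch_point {T : Type} (X : (nat -> T) -> Prop) (y : nat -> T) : Prop :=
  X y /\ exists x1 x2, X x1 /\ X x2 /\ x1 <> x2 /\ shift x1 = y /\ shift x2 = y.

Definition quasi_invertible {T : Type} (X : (nat -> T) -> Prop) : Prop :=
  exists y, branch_point X y /\ forall z, branch_point X z -> z = y.

(* V_0 = {v0}, V_n = V (n >= 1).  E_1 = {(a,i) : a in V, i < n1 a}, edge  *)
(* (a,i) goes from v0 to a, ordered by i.  For n >= 2,                     *)
(* E_n = {(a,i) : i < |theta a|}, edge (a,i) has range a and source the   *)
(* i-th letter of theta(a), ordered by i.  A path is x : nat -> V * nat,  *)
(* where x j is the edge of E_(j+1) (edge from level j to level j+1).     *)

Record sbd := SBD {
  sV : finType;
  stheta : sV -> seq sV;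
  sn1 : sV -> nat
}.

Section Bratteli.
Variable B : sbd.
Local Notation V := (sV B).
Local Notation theta := (@stheta B).
Local Notation n1 := (@sn1 B).

Definition Bwf : Prop :=
  (exists a : V, True) /\            (* V_1 nonempty (v0 is a source) *)
  (forall a, 0 < n1 a) /\            (* every vertex of V_1 is a range *)
  (forall a, theta a != [::]) /\     (* every vertex of V_n, n>=2, is a range *)
  (forall b, exists a, b \in theta a). (* every vertex of V_n, n>=1, is a source *)

(* source of an edge of level >= 2 *)
Definition esrc (e : V * nat) : V := nth e.1 (theta e.1) e.2.

(* number of edges with range a in E_(j+1) *)
Definition ebound (j : nat) (a : V) : nat :=
  if j is 0 then n1 a else size (theta a).

Definition is_path (x : nat -> V * nat) : Prop :=
  forall j, (x j).2 < ebound j (x j).1 /\ esrc (x j.+1) = (x j).1.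

Definition XB : (nat -> V * nat) -> Prop := is_path.

Definition nonmax (j : nat) (e : V * nat) : bool := (e.2).+1 < ebound j e.1.

Definition is_min_path (x : nat -> V * nat) : Prop :=
  is_path x /\ forall j, (x j).2 = 0.

Definition simple : Prop := primitive theta.

Definition semi_proper : Prop :=
  simple /\ exists m, is_min_path m /\ forall m', is_min_path m' -> m' = m.

(* the Vershik map, extended to maximal paths by sending them to the
   (unique, under semi-properness) minimal path *)
Definition vershik (x : nat -> V * nat) : nat -> V * nat :=
  match excluded_middle_informative (exists k, nonmax k (x k)) with
  | left H =>
      let k := @ex_minn (fun k => nonmax k (x k)) H in
      let a := (x k).1 in
      let i := (x k).2 in
      let s := esrc (a, i.+1) in
      fun j => if j < k then (iter (k.-1 - j) (fun c => head c (theta c)) s, 0)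
               else if j == k then (a, i.+1) else x j
  | right _ =>
      match excluded_middle_informative (exists m, is_min_path m) with
      | left H => proj1_sig (constructive_indefinite_description _ H)
      | right _ => x
      end
  end.

End Bratteli.

(* Main.v *)
Require Import Defs.
From mathcomp Require Import all_boot zify.
From Stdlib Require Import ClassicalEpsilon FunctionalExtensionality.

Set Implicit Arguments.
Unset Strict Implicit.
Unset Printing Implicit Defensive.

(* Let z be the branch point and let f be a power of tau with all images of
   length at least 2. Recognizability forces ext f z to lie on the forward
   orbit of z, say shiftn S z = ext f z. Prepending the first S letters of z
   to ext f gives a map T that fixes z, and by compactness T maps a small
   cylinder C around z into itself, with T (shiftn q y) equal to T y shifted
   by |f(y_0 ... y_(q-1))| whenever y and shiftn q y are in C. The towers over
   T^n(C) are then nested Kakutani-Rokhlin partitions with the same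
   combinatorics at every level, hence given by a stationary ordered
   diagram, whose unique minimal path codes z. A point of the one-sided
   subshift determines its position in every tower: two distinct pasts of a
   point can only meet at z, and z lies in all the bases. *)

(** * Sequences and morphisms *)

Definition shiftn (T : Type) (n : nat) (x : nat -> T) : nat -> T :=
  fun i => x (n + i).

Definition agree (T : Type) (n : nat) (x y : nat -> T) : Prop :=
  forall i, i < n -> x i = y i.

Section Sequences.
Variable T : Type.
Implicit Types x y z : nat -> T.

Lemma shiftnD m n x : shiftn (m + n) x = shiftn n (shiftn m x).
Proof. by apply: functional_extensionality => i; rewrite /shiftn addnA. Qed.

Lemma agree_sym n x y : agree n x y -> agree n y x.
Proof. by move=> h i /h. Qed.

Lemma agree_trans n x y z : agree n x y -> agree n y z -> agree n x z.
Proof. by move=> h1 h2 i hi; rewrite h1 ?h2. Qed.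

Lemma agree_leq m n x y : m <= n -> agree n x y -> agree m x y.
Proof. by move=> hmn h i hi; apply: h; lia. Qed.

Lemma agree_shiftn m n x y :
  agree (m + n) x y -> agree n (shiftn m x) (shiftn m y).
Proof. by move=> h i hi; apply: h; lia. Qed.

Lemma agree_ext x y : (forall n, agree n x y) -> x = y.
Proof. by move=> h; apply: functional_extensionality => i; apply: (h i.+1). Qed.

Lemma agree_mkseq n x y : agree n x y <-> mkseq x n = mkseq y n.
Proof.
split=> [h|h i hi].
  by apply/eq_in_map => i; rewrite mem_iota add0n => /andP[_ /h].
by rewrite -(nth_mkseq (x 0) x hi) -(nth_mkseq (x 0) y hi) h.
Qed.

Lemma mkseqDshift m n x : mkseq x (m + n) = mkseq x m ++ mkseq (shiftn m x) n.
Proof.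
rewrite /mkseq iotaD map_cat add0n; congr cat.
by rewrite -[m in iota m n]addn0 iotaDl -map_comp.
Qed.

End Sequences.

Lemma infinite_pigeonhole (T : eqType) (l : seq T) (P : nat -> T -> Prop) :
  (forall N, exists n, exists t, [/\ N <= n, t \in l & P n t]) ->
  exists t, forall N, exists n, N <= n /\ P n t.
Proof.
elim: l => [|a l IH] h.
  by have [n [t [_]]] := h 0; rewrite in_nil.
case: (classic (forall N, exists n, N <= n /\ P n a)) => [ha|]; first by exists a.
move=> /not_all_ex_not [N0 hN0]; apply: IH => N.
have [n [t [hn ht hP]]] := h (maxn N N0).
exists n, t; split=> //; first by lia.
move: ht; rewrite inE => /orP[/eqP ta|//].
by case: hN0; exists n; rewrite -ta; split=> //; lia.
Qed.

(** Compactness by König's argument: a word that begins [f m] for arbitrarily large [m] can be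
    prolonged by one letter with the same property. The alphabet is a list because the edges of the
    diagram live in an infinite type. *)
Lemma cluster_point (T : eqType) (l : seq T) (f : nat -> nat -> T) :
  (forall m i, f m i \in l) ->
  exists g : nat -> T, forall n N, exists m, N <= m /\ agree n (f m) g.
Proof.
move=> hl.
pose inf (w : seq T) := forall N, exists m, N <= m /\ mkseq (f m) (size w) = w.
have step w : inf w -> exists t, inf (rcons w t).
  move=> hw.
  case: (@infinite_pigeonhole T l
      (fun m t => mkseq (f m) (size w) = w /\ f m (size w) = t)).
    by move=> N; have [m [hm h]] := hw N; exists m, (f m (size w)).
  move=> t ht; exists t => N; have [m [hm [h1 h2]]] := ht N.
  by exists m; rewrite size_rcons mkseqS h1 h2.
have [g0 _] : exists t0 : T, True by exists (f 0 0).
pose nxt w := epsilon (inhabits g0) (fun t => inf (rcons w t)).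
have hn w : inf w -> inf (rcons w (nxt w)).
  by move=> /step; apply: epsilon_spec.
pose pre := fix pre n := if n is n'.+1 then rcons (pre n') (nxt (pre n')) else [::].
have hp n : inf (pre n) by elim: n => [|n /hn//]; move=> N; exists N.
have sp n : size (pre n) = n by elim: n => //= n IH; rewrite size_rcons IH.
have gp n : mkseq (fun i => nxt (pre i)) n = pre n.
  by elim: n => //= n IH; rewrite mkseqS IH.
exists (fun i => nxt (pre i)) => n N.
have [m [hm h]] := hp n N; exists m; split=> //.
by apply/agree_mkseq; rewrite gp -[in LHS](sp n).
Qed.

Section Morphism.
Variables (A : finType) (f : A -> seq A).
Hypothesis f_neq0 : forall a, f a != [::].
Implicit Types (x y : nat -> A) (w : seq A).

(** The action of the morphism on infinite words. When [f] is non-erasing, the first [i.+1] letters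
    have an image longer than [i], so the default [y 0] is never returned. *)
Definition ext y : nat -> A := fun i => nth (y 0) (tauw f (mkseq y i.+1)) i.

Definition elen y n : nat := size (tauw f (mkseq y n)).

Lemma tauw_cat w1 w2 : tauw f (w1 ++ w2) = tauw f w1 ++ tauw f w2.
Proof. by rewrite /tauw map_cat flatten_cat. Qed.

Lemma size_tauw c w : (forall a, c <= size (f a)) -> c * size w <= size (tauw f w).
Proof.
move=> hc; elim: w => [|a w IH]; first by rewrite muln0.
by rewrite /tauw /= size_cat mulnS leq_add.
Qed.

Lemma elenD y m n : elen y (m + n) = elen y m + elen (shiftn m y) n.
Proof. by rewrite /elen mkseqDshift tauw_cat size_cat. Qed.

Lemma elen_lower c y n : (forall a, c <= size (f a)) -> c * n <= elen y n.
Proof. by move=> /size_tauw hc; rewrite -{1}(size_mkseq y n); apply: hc. Qed.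

Lemma elen_ge y n : n <= elen y n.
Proof.
by rewrite -[n in n <= _]mul1n; apply: elen_lower => a; rewrite lt0n size_eq0.
Qed.

Lemma elen0 y : elen y 0 = 0. Proof. by []. Qed.

Lemma elen1 y : elen y 1 = size (f (y 0)).
Proof. by rewrite /elen /tauw /= cats0. Qed.

Lemma elen_mono y m n : m <= n -> elen y m <= elen y n.
Proof. by move=> /subnKC <-; rewrite elenD leq_addr. Qed.

Lemma elen_agree n x y : agree n x y -> elen x n = elen y n.
Proof. by move=> /agree_mkseq h; rewrite /elen h. Qed.

Lemma nth_tauw_mkseq d y m n i : m <= n -> i < elen y m ->
  nth d (tauw f (mkseq y n)) i = nth d (tauw f (mkseq y m)) i.
Proof.
by move=> /subnKC <- hi; rewrite mkseqDshift tauw_cat nth_cat -/(elen y m) hi.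
Qed.

Lemma extE d y n i : i < elen y n -> ext y i = nth d (tauw f (mkseq y n)) i.
Proof.
move=> hi; have hi' : i < elen y i.+1 := elen_ge y i.+1.
rewrite /ext (set_nth_default d) //.
case: (leqP n i.+1) => h; first by rewrite (nth_tauw_mkseq d h).
by rewrite (nth_tauw_mkseq d (ltnW h)).
Qed.

Lemma mkseq_ext y n : mkseq (ext y) (elen y n) = tauw f (mkseq y n).
Proof.
apply: (@eq_from_nth _ (y 0)); first by rewrite size_mkseq.
by move=> i; rewrite size_mkseq => hi; rewrite nth_mkseq // (extE (y 0) hi).
Qed.

Lemma ext_agree n x y : agree n x y -> agree (elen x n) (ext x) (ext y).
Proof.
move=> h; apply/agree_mkseq; rewrite mkseq_ext (elen_agree h) mkseq_ext.
by move/agree_mkseq: h => ->.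
Qed.

Lemma ext_shiftn q y : ext (shiftn q y) = shiftn (elen y q) (ext y).
Proof.
apply: functional_extensionality => i; rewrite /shiftn -/(shiftn q y).
have hi : i < elen (shiftn q y) i.+1 := elen_ge _ _.
have hi' : elen y q + i < elen y (q + i.+1) by rewrite elenD ltn_add2l.
rewrite (extE (y 0) hi) (extE (y 0) hi') mkseqDshift tauw_cat nth_cat.
by rewrite ltnNge leq_addr /= addKn.
Qed.

Lemma ext_uniq y x :
  (forall n, mkseq x (elen y n) = tauw f (mkseq y n)) -> x = ext y.
Proof.
move=> h; apply: agree_ext => n; apply: (agree_leq (elen_ge y n)).
by apply/agree_mkseq; rewrite h mkseq_ext.
Qed.

Lemma fixed_pointE u : fixed_point f u -> ext u = u.
Proof.
move=> h; apply: functional_extensionality => i.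
exact: (h i.+1 i (elen_ge u i.+1)).
Qed.

End Morphism.

Section Composition.
Variables (A : finType) (f g : A -> seq A).
Hypotheses (f_neq0 : forall a, f a != [::]) (g_neq0 : forall a, g a != [::]).

Lemma tauw_neq0 w : w != [::] -> tauw f w != [::].
Proof.
case: w => [//|a w] _; rewrite -size_eq0 /tauw /= size_cat addn_eq0 size_eq0.
by rewrite (negPf (f_neq0 a)).
Qed.

Lemma tauw_comp w : tauw (tauw f \o g) w = tauw f (tauw g w).
Proof. by elim: w => //= a w IH; rewrite /tauw /= -!/(tauw _ _) tauw_cat IH. Qed.

Lemma elen_comp y n : elen (tauw f \o g) y n = elen f (ext g y) (elen g y n).
Proof. by rewrite /elen -/(elen g y n) mkseq_ext // tauw_comp. Qed.

Lemma ext_comp y : ext (tauw f \o g) y = ext f (ext g y).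
Proof.
symmetry; apply: ext_uniq => [a|n]; first exact: tauw_neq0.
by rewrite elen_comp mkseq_ext // mkseq_ext // tauw_comp.
Qed.

End Composition.

(** Unique desubstitution, stated for points: besides locating the cutting points it contains,
    through [i = 0] and for non-erasing [f], the injectivity of [ext f] on [X]. In this form it is
    stable under composition. *)
Definition recognizable (A : finType) (X : (nat -> A) -> Prop) (f : A -> seq A) :=
  forall i y y', X y -> X y' -> shiftn i (ext f y) = ext f y' ->
  exists q, i = elen f y q /\ y' = shiftn q y.

Lemma recognizable_comp (A : finType) (X : (nat -> A) -> Prop) (f g : A -> seq A) :
  (forall a, f a != [::]) -> (forall a, g a != [::]) ->
  (forall y, X y -> X (ext g y)) ->
  recognizable X f -> recognizable X g -> recognizable X (tauw f \o g).
Proof.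
move=> f0 g0 Xg Rf Rg i y y' Xy Xy'; rewrite !ext_comp // => e.
have [q [-> /esym e2]] := Rf _ _ _ (Xg _ Xy) (Xg _ Xy') e.
have [q' [-> ->]] := Rg _ _ _ Xy Xy' e2.
by exists q'; rewrite elen_comp.
Qed.

(** * The subshift of a primitive substitution *)

(** The dynamical properties of the subshift on which the tower construction rests. [am_minimal] is
    uniform recurrence: the bound on the waiting time is the same for all points of [X]. *)
Record aperiodic_minimal (A : finType) (X : (nat -> A) -> Prop) : Prop := {
  am_shiftn : forall n x, X x -> X (shiftn n x);
  am_closed : forall x, (forall n, exists y, X y /\ agree n x y) -> X x;
  am_onto : forall x, X x -> exists x', X x' /\ shiftn 1 x' = x;
  am_minimal : forall y n, X y ->
    exists N, forall x, X x -> exists j, j < N /\ agree n (shiftn j x) y;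
  am_aperiodic : forall q x, X x -> shiftn q x = x -> q = 0
}.

(** * Powers of a substitution and of its incidence matrix *)

Section Powers.
Variables (A : finType) (tau : A -> seq A).
Implicit Types (a b c : A) (w : seq A).

Definition subst_pow k a : seq A := iterw tau k [:: a].

Lemma tauw_flatten k w : tauw (subst_pow k) w = iterw tau k w.
Proof.
elim: k w => [|k IH] w.
  by elim: w => //= a w; rewrite /tauw /= => ->.
rewrite /iterw /= -/(iterw tau k w) -IH.
by rewrite -(tauw_comp tau (subst_pow k)).
Qed.

Lemma subst_powD k l a : subst_pow (k + l) a = tauw (subst_pow k) (subst_pow l a).
Proof. by rewrite tauw_flatten /subst_pow /iterw iterD. Qed.

Lemma count_tauw b w :
  count_mem b (tauw tau w) = \sum_(c : A) count_mem c w * count_mem b (tau c).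
Proof.
elim: w => [|a w IH]; first by rewrite big1.
rewrite /tauw /= count_cat -/(tauw tau w) IH.
under [RHS]eq_bigr => c _ do rewrite mulnDl.
rewrite big_split /=; congr addn.
rewrite (bigD1 a) //= eqxx mul1n big1 ?addn0 // => c /negPf.
by rewrite eq_sym => ->.
Qed.

(** Turns positivity of a power of the incidence matrix into the occurrence of letters in iterated
    images. *)
Lemma incpowE k a b : incpow tau k a b = count_mem b (iterw tau k [:: a]).
Proof.
elim: k b => [|k IH] b /=; first by rewrite addn0.
by rewrite count_tauw; apply: eq_bigr => c _; rewrite IH.
Qed.

Lemma incpow_gt0 k a b : (0 < incpow tau k a b) = (b \in iterw tau k [:: a]).
Proof. by rewrite incpowE -has_count has_pred1. Qed.

Hypothesis tau_neq0 : forall a, tau a != [::].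

Lemma subst_pow_neq0 k a : subst_pow k a != [::].
Proof. by elim: k => [//|k IH]; apply: tauw_neq0. Qed.

Lemma subst_pow_fixed u k : ext tau u = u -> ext (subst_pow k) u = u.
Proof.
move=> hu; elim: k => [|k IH].
  symmetry; apply: ext_uniq => // n.
  have h w : tauw (subst_pow 0) w = w by rewrite tauw_flatten.
  by rewrite /elen h size_mkseq.
by have := ext_comp tau_neq0 (subst_pow_neq0 k) u; rewrite IH hu.
Qed.

Lemma subst_pow_grow K n a : (forall a, 1 < size (subst_pow K a)) ->
  n < size (subst_pow (n * K) a).
Proof.
move=> hK; apply: (@leq_trans (2 ^ n)); first exact: ltn_expl.
elim: n => [|n IH]; first by rewrite mul0n.
rewrite mulSn subst_powD expnS.
by apply: leq_trans (size_tauw _ hK); rewrite leq_mul2l IH orbT.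
Qed.

End Powers.

Section SubstitutionSubshift.
Variables (A : finType) (tau : A -> seq A) (u : nat -> A).
Hypotheses (tau_neq0 : forall a, tau a != [::])
  (tau_prim : primitive tau)
  (X_infinite : infinite_set (Xtau u))
  (tau_recog : unilaterally_recognizable tau u)
  (tau_inj : injective tau)
  (tau_fixed : fixed_point tau u).

Let u_ext k : ext (subst_pow tau k) u = u.
Proof. exact: subst_pow_fixed (fixed_pointE tau_neq0 tau_fixed). Qed.

Lemma Xtau_shiftn k x : Xtau u x -> Xtau u (shiftn k x).
Proof.
move=> hx n; have [m hm] := hx (k + n); exists (m + k) => i hi.
by rewrite /shiftn hm ?ltn_add2l // addnA.
Qed.

Lemma Xtau_closed x : (forall n, exists y, Xtau u y /\ agree n x y) -> Xtau u x.
Proof.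
by move=> h n; have [y [/(_ n)[m hm] hy]] := h n; exists m => i hi; rewrite hy ?hm.
Qed.

Lemma Xtau_agree n x : Xtau u x -> exists m, agree n x (shiftn m u).
Proof. by move=> /(_ n). Qed.

Lemma Xtau_ext f y : (forall a, f a != [::]) -> ext f u = u ->
  Xtau u y -> Xtau u (ext f y).
Proof.
move=> f0 fu hy n; have [m hm] := Xtau_agree n hy.
exists (elen f u m) => i hi.
have hi' : i < elen f y n := leq_trans hi (elen_ge f0 _ _).
by have -> := ext_agree f0 hm hi'; rewrite ext_shiftn // fu.
Qed.

Lemma two_letters : exists a b : A, a != b.
Proof.
apply: NNPP => h; apply: X_infinite; exists 1, (fun _ => u) => x _; exists ord0.
apply: functional_extensionality => i; apply/eqP; apply/negPn/negP => hi.
by apply: h; exists (x i), (u i).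
Qed.

Lemma primitive_pow_large : exists K,
  (forall a, 1 < size (subst_pow tau K a)) /\
  forall a b, b \in subst_pow tau K a.
Proof.
have [K [_ hK]] := tau_prim; exists K.
have hin a b : b \in subst_pow tau K a by rewrite -incpow_gt0.
split=> // c; have [a [b hab]] := two_letters.
move: (hin c a) (hin c b); case: (subst_pow _ _ _) => [//|d [|//]].
by rewrite !inE => /eqP ea /eqP eb; rewrite ea eb eqxx in hab.
Qed.

(** Every [g]-image of a letter contains the [k]-th image of [u 0], a prefix of [u] long enough to
    contain the wanted word. Since [u] is fixed by [g], it is a concatenation of such blocks, whose
    lengths are bounded by [Mx]. *)
Lemma uniform_recurrence m' n : exists N, forall m, exists j,
  j < N /\ agree n (shiftn (m + j) u) (shiftn m' u).
Proof.
have [K [hK1 hK2]] := primitive_pow_large.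
pose k := (m' + n) * K; pose g := subst_pow tau (k + K).
have g0 : forall a, g a != [::] by exact: subst_pow_neq0.
have gE a : exists w1 w2, g a = w1 ++ subst_pow tau k (u 0) ++ w2.
  rewrite /g subst_powD.
  case/splitPr: (hK2 a (u 0)) => w1 w2; rewrite -cat1s 2!tauw_cat.
  exists (tauw (subst_pow tau k) w1), (tauw (subst_pow tau k) w2).
  by rewrite {2}/tauw /= cats0.
have hsz : m' + n < size (subst_pow tau k (u 0)) by exact: subst_pow_grow.
have upre : subst_pow tau k (u 0) = mkseq u (size (subst_pow tau k (u 0))).
  have := mkseq_ext (subst_pow_neq0 tau_neq0 k) u 1.
  by rewrite u_ext elen1 /tauw /= cats0.
pose Mx := \max_a size (g a).
have hMx a : size (g a) <= Mx by exact: leq_bigmax.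
(* At most [Mx] letters lead from [m] to a cutting point, and at most [Mx] more to the occurrence
   inside the next block. *)
exists (Mx + Mx).+1 => m.
have [q [hq1 hq2]] : exists q, m <= elen g u q <= m + Mx /\ True.
  elim: m => [|m [q [hq _]]]; first by exists 0; rewrite elen0.
  case: (leqP m.+1 (elen g u q)) => h; first by exists q; split=> //; lia.
  exists (q + 1); split=> //; rewrite elenD elen1.
  have := hMx (shiftn q u 0); have := g0 (shiftn q u 0); rewrite -size_eq0.
  by case: (size _) => [//|s] _; lia.
have [w1 [w2 hw]] := gE (u q).
exists (elen g u q - m + size w1 + m'); split.
  by have := hMx (u q); rewrite hw !size_cat; lia.
move=> i hi; rewrite /shiftn.
have -> : m + (elen g u q - m + size w1 + m') + i =
    elen g u q + (size w1 + (m' + i)) by lia.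
have uS : shiftn (elen g u q) u = ext g (shiftn q u) by rewrite ext_shiftn // u_ext.
rewrite -/(shiftn (elen g u q) u _) uS.
have e1 : elen g (shiftn q u) 1 = size (g (u q)) by rewrite elen1 /shiftn addn0.
rewrite (@extE _ _ g0 (u 0) _ 1); last by rewrite e1 hw !size_cat; lia.
rewrite /tauw /= cats0 /shiftn addn0 hw nth_cat.
rewrite ltnNge leq_addr /= addKn nth_cat ifT; last by lia.
by rewrite upre nth_mkseq //; lia.
Qed.

(** Each prefix of [x] occurs in [u] at a positive position, hence after some letter. By the
    pigeonhole principle one letter precedes arbitrarily long prefixes, and it can be put in front
    of [x]. *)
Lemma Xtau_onto x : Xtau u x -> exists x', Xtau u x' /\ shiftn 1 x' = x.
Proof.
move=> hx.
have [a ha] : exists a, forall N, exists n, N <= n /\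
    exists m, agree n x (shiftn m.+1 u) /\ u m = a.
  apply: (@infinite_pigeonhole _ (enum A)) => N; exists N.
  have [m' hm'] := Xtau_agree N hx.
  have [_ /(_ 1)[j [_ hj]]] := uniform_recurrence m' N.
  exists (u j); split; rewrite ?mem_enum //.
  exists j; split=> //; rewrite -add1n.
  exact: agree_trans hm' (agree_sym hj).
exists (fun i => if i is j.+1 then x j else a); split=> // n.
have [n' [hn [m [h1 h2]]]] := ha n.
by exists m => [[|i] hi]; rewrite ?addn0 // h1 ?/shiftn ?addSnnS //; lia.
Qed.

Lemma Xtau_minimal y n : Xtau u y ->
  exists N, forall x, Xtau u x -> exists j, j < N /\ agree n (shiftn j x) y.
Proof.
move=> /(Xtau_agree n)[m' hm'].
have [N hN] := uniform_recurrence m' n; exists N => x hx.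
have [m hm] := Xtau_agree (N + n) hx.
have [j [hj1 hj2]] := hN m; exists j; split=> //.
apply: agree_trans (agree_sym hm'); apply: agree_trans hj2.
by rewrite shiftnD; apply: agree_shiftn; apply: agree_leq hm; lia.
Qed.

(** If [x] had a period [q > 0], minimality would make every point of the subshift one of the first
    [q] shifts of [x], and the subshift would be finite. *)
Lemma Xtau_aperiodic q x : Xtau u x -> shiftn q x = x -> q = 0.
Proof.
move=> hx e; case: (posnP q) => // q0; case: X_infinite.
have per k : shiftn (k * q) x = x by elim: k => // k IH; rewrite mulSn shiftnD e.
exists q, (fun i : 'I_q => shiftn i x) => y hy.
have [j hj] : exists j, forall N, exists n,
    N <= n /\ (j < q /\ agree n (shiftn j x) y).
  apply: (@infinite_pigeonhole _ (iota 0 q)) => n; exists n.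
  have [_ /(_ x hx)[j [_ hj]]] := Xtau_minimal n hy.
  have hmod : j %% q < q by rewrite ltn_mod.
  exists (j %% q); rewrite mem_iota; split=> //; split=> //.
  by move: hj; rewrite {1}(divn_eq j q) shiftnD per.
have [_ [_ [hjq _]]] := hj 0; exists (Ordinal hjq) => /=; symmetry.
by apply: agree_ext => n; have [n' [hn [_ h]]] := hj n; apply: agree_leq h.
Qed.

Lemma Xtau_aperiodic_minimal : aperiodic_minimal (Xtau u).
Proof.
split; [exact: Xtau_shiftn|exact: Xtau_closed|exact: Xtau_onto|exact: Xtau_minimal|
  exact: Xtau_aperiodic].
Qed.

(** Recognizability is known for [u] only, so [y] and [y'] are replaced by shifts of [u] that agree
    with them on [i + L] and [L] letters. The window at the cutting point of index [m'] then
    reappears [i] letters after that of index [m]. *)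
Lemma Xtau_cut i y y' : Xtau u y -> Xtau u y' ->
  shiftn i (ext tau y) = ext tau y' -> exists q, i = elen tau y q.
Proof.
move=> hy hy' e; have [L hL] := tau_recog.
have hu := fixed_pointE tau_neq0 tau_fixed.
have [m hm] := Xtau_agree (i + L) hy.
have [m' hm'] := Xtau_agree L hy'.
have cutM k : Defs.inE tau u (elen tau u k) by exists k.
have yE : agree (i + L) (ext tau y) (shiftn (elen tau u m) u).
  rewrite -{2}hu -ext_shiftn //; apply: agree_leq (ext_agree tau_neq0 hm).
  exact: elen_ge.
have yE' : agree L (ext tau y') (shiftn (elen tau u m') u).
  rewrite -{2}hu -ext_shiftn //; apply: agree_leq (ext_agree tau_neq0 hm').
  exact: elen_ge.
have [q hq] : Defs.inE tau u (elen tau u m + i).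
  apply: hL (cutM m') _ => k hk.
  rewrite -addnA -/(shiftn (elen tau u m') u k) -yE' // -e /shiftn yE ?ltn_add2l //.
rewrite -/(elen tau u q) in hq.
have hmq : m <= q.
  rewrite leqNgt; apply/negP => h.
  have := elen_mono tau u h; have := elenD tau u q 1; rewrite elen1 addn1.
  have := tau_neq0 (shiftn q u 0); rewrite -size_eq0; case: (size _) => // s _; lia.
have hi : i = elen tau (shiftn m u) (q - m).
  by have := elenD tau u m (q - m); rewrite subnKC // -hq; lia.
exists (q - m); rewrite hi; symmetry; apply: elen_agree; apply: agree_leq hm.
by have := elen_ge tau_neq0 (shiftn m u) (q - m); rewrite -hi; lia.
Qed.

(** The end of the first block of either word is a nonzero cutting point for the other, so the two
    first blocks have equal length and coincide; [tau_inj] concludes. *)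
Lemma Xtau_ext_head y y' : Xtau u y -> Xtau u y' ->
  ext tau y = ext tau y' -> y 0 = y' 0.
Proof.
move=> hy hy' e.
have half z z' : Xtau u z -> Xtau u z' -> ext tau z = ext tau z' ->
    elen tau z' 1 <= elen tau z 1.
  move=> hz hz' ez.
  have e1 : shiftn (elen tau z 1) (ext tau z') = ext tau (shiftn 1 z).
    by rewrite -ez ext_shiftn.
  have [q hq] := Xtau_cut hz' (Xtau_shiftn 1 hz) e1.
  rewrite hq; case: q hq => [|q] hq; last exact: elen_mono.
  by have := elen_ge tau_neq0 z 1; rewrite hq elen0.
have es : elen tau y 1 = elen tau y' 1.
  by apply/eqP; rewrite eqn_leq !half.
apply: tau_inj; have := mkseq_ext tau_neq0 y 1; have := mkseq_ext tau_neq0 y' 1.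
by rewrite es e => ->; rewrite /tauw /= !cats0.
Qed.

Lemma Xtau_ext_inj y y' : Xtau u y -> Xtau u y' -> ext tau y = ext tau y' -> y = y'.
Proof.
move=> hy hy' e; apply: functional_extensionality => n.
suff h k : ext tau (shiftn k y) = ext tau (shiftn k y').
  have := Xtau_ext_head (Xtau_shiftn n hy) (Xtau_shiftn n hy') (h n).
  by rewrite /shiftn addn0.
elim: k => [//|k IH]; rewrite -addn1 !shiftnD.
have h0 := Xtau_ext_head (Xtau_shiftn k hy) (Xtau_shiftn k hy') IH.
by rewrite !(ext_shiftn tau_neq0 1) IH !elen1 h0.
Qed.

Lemma Xtau_recognizable : recognizable (Xtau u) tau.
Proof.
move=> i y y' hy hy' e; have [q hq] := Xtau_cut hy hy' e.
exists q; split=> //; apply: (Xtau_ext_inj hy' (Xtau_shiftn q hy)).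
by rewrite ext_shiftn // -hq.
Qed.

Lemma Xtau_expanding_power : exists f : A -> seq A,
  [/\ forall a, 1 < size (f a), forall y, Xtau u y -> Xtau u (ext f y)
    & recognizable (Xtau u) f].
Proof.
have [K [hK _]] := primitive_pow_large; exists (subst_pow tau K).
have n0 k : forall a, subst_pow tau k a != [::] by exact: subst_pow_neq0.
split=> // [y|]; first exact: Xtau_ext.
(* The zeroth power acts as the identity; each further factor [tau] is added by composition. *)
elim: K {hK} => [|K IH].
  move=> i y y' _ _ e; exists i; have e0 z : ext (subst_pow tau 0) z = z.
    symmetry; apply: ext_uniq => // n.
    by rewrite /elen !tauw_flatten size_mkseq.
  by rewrite /elen tauw_flatten size_mkseq -(e0 y') -e e0.
apply: (recognizable_comp tau_neq0 (n0 K) _ Xtau_recognizable IH) => y.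
exact: Xtau_ext.
Qed.

End SubstitutionSubshift.

(** * The branch point *)

Section BranchPoint.
Variables (A : finType) (X : (nat -> A) -> Prop) (z : nat -> A).
Hypotheses (am : aperiodic_minimal X) (z_branch : branch_point X z)
  (z_uniq : forall z', branch_point X z' -> z' = z).

Let Xz : X z := proj1 z_branch.

(** When two different points have orbits that merge, the point where they first coincide has two
    preimages in [X], so it is the branch point. *)
Lemma shiftn_eq_branch i x x' : X x -> X x' -> shiftn i x = shiftn i x' ->
  x = x' \/ exists j, [/\ 0 < j <= i, shiftn j x = z & shiftn j x' = z].
Proof.
move=> hx hx'; elim: i => [|i IH]; first by left.
rewrite -addn1 => e.
case: (classic (shiftn i x = shiftn i x')) => [/IH [|[j [hj h1 h2]]]|ne].
- by left.
- by right; exists j; split=> //; lia.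
right; exists (i + 1); rewrite -e; suff h : shiftn (i + 1) x = z by split=> //; lia.
apply: z_uniq; split; first exact: am_shiftn.
exists (shiftn i x), (shiftn i x'); split; first exact: am_shiftn.
split; first exact: am_shiftn.
by split=> //; split; [rewrite shiftnD|rewrite e shiftnD].
Qed.

Lemma shiftn_onto n x : X x -> exists x', X x' /\ shiftn n x' = x.
Proof.
elim: n x => [|n IH] x hx; first by exists x.
have [y [hy <-]] := am_onto am hx; have [x' [hx' <-]] := IH y hy.
by exists x'; rewrite -shiftnD addn1.
Qed.

Lemma X_closure x (l : nat -> nat -> A) :
  (forall n, X (l n)) -> (forall n N, exists m, N <= m /\ agree n (l m) x) -> X x.
Proof.
move=> hl h; apply: (am_closed am) => n; have [m [_ hm]] := h n 0.
by exists (l m); split=> //; apply: agree_sym.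
Qed.

Variable f : A -> seq A.
Hypotheses (f_size : forall a, 1 < size (f a))
  (X_ext : forall y, X y -> X (ext f y)) (f_recog : recognizable X f).

Lemma size_neq0 a : f a != [::].
Proof. by rewrite -size_eq0; have := f_size a; case: size. Qed.
Let f0 := size_neq0.

(* If the orbit of z missed ext f z, then no iterated preimage of ext f z
   would be a branch point, so the images of two distinct preimages of z would lie
   on the same backward orbit, contradicting recognizability. *)
Lemma ext_branch_point : exists S, shiftn S z = ext f z.
Proof.
apply: NNPP => /not_ex_all_not hS.
have [_ [x1 [x2 [hx1 [hx2 [ne [e1 e2]]]]]]] := z_branch.
have {e1}e1 : shiftn 1 x1 = z by [].
have {e2}e2 : shiftn 1 x2 = z by [].
wlog hle : x1 x2 hx1 hx2 ne e1 e2 / elen f x1 1 <= elen f x2 1.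
  move=> h; case: (leqP (elen f x1 1) (elen f x2 1)) => [|/ltnW] hle.
    exact: (h x1 x2).
  by apply: (h x2 x1) => // e; apply: ne.
have s1 : shiftn (elen f x1 1) (ext f x1) = ext f z by rewrite -ext_shiftn // e1.
have s2 : shiftn (elen f x2 1) (ext f x2) = ext f z by rewrite -ext_shiftn // e2.
case: (@shiftn_eq_branch (elen f x1 1) (ext f x1)
  (shiftn (elen f x2 1 - elen f x1 1) (ext f x2))).
- exact: X_ext.
- by apply: (am_shiftn am); apply: X_ext.
- by rewrite -shiftnD subnK // s1.
- move=> e; have [q [hq hxq]] := f_recog hx2 hx1 (esym e).
  case: q hq hxq => [_ h|q _]; first by apply: ne.
  rewrite -[q.+1]add1n shiftnD e2 => h; rewrite h -shiftnD in e1.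
  by have := am_aperiodic am Xz e1; lia.
move=> [j [hj h1 _]]; apply: (hS (elen f x1 1 - j)).
by rewrite -{1}h1 -shiftnD subnKC ?(proj2 (andP hj)).
Qed.

(** * The delayed substitution, which fixes the branch point *)

Section Delay.
Variable S : nat.
Hypothesis zS : shiftn S z = ext f z.

Definition delay (y : nat -> A) : nat -> A :=
  fun i => if i < S then z i else ext f y (i - S).

Lemma shiftn_delay y : shiftn S (delay y) = ext f y.
Proof.
apply: functional_extensionality => i.
by rewrite /shiftn /delay ltnNge leq_addr addKn.
Qed.

Lemma delayP x y : agree S x z -> shiftn S x = ext f y -> x = delay y.
Proof.
move=> h e; apply: functional_extensionality => i; rewrite /delay.
case: ltnP => hi; first exact: h.
by rewrite -e /shiftn subnKC.
Qed.

Lemma delay_z : delay z = z.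
Proof. by symmetry; apply: delayP. Qed.

Lemma delay_agree n y y' :
  agree n y y' -> agree (S + elen f y n) (delay y) (delay y').
Proof.
move=> /(ext_agree f0) h i hi; rewrite /delay; case: ltnP => // hiS.
by apply: h; lia.
Qed.

Lemma delay_recog i y y' : X y -> X y' -> shiftn i (delay y) = delay y' ->
  exists q, i = elen f y q /\ y' = shiftn q y.
Proof.
move=> hy hy' e; apply: f_recog => //.
by rewrite -(shiftn_delay y) -(shiftn_delay y') -e -!shiftnD addnC.
Qed.

(* Long pasts of ext f z pass through z, so they end with the first S letters
   of z; by compactness the same holds for long pasts of ext f y when y is
   close to z. *)
Lemma delay_of_past : exists P, forall x, X x -> agree P (shiftn S x) z ->
  shiftn (elen f x S - S) (ext f x) = delay (shiftn S x).
Proof.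
have lenS x : S <= elen f x S by apply: elen_ge.
pose good x := agree S (shiftn (elen f x S - S) (ext f x)) z.
have goodP x : good x -> shiftn (elen f x S - S) (ext f x) = delay (shiftn S x).
  by move=> h; apply: delayP => //; rewrite -shiftnD subnK // ext_shiftn.
suff [P hP] : exists P, forall x, X x -> agree P (shiftn S x) z -> good x.
  by exists P => x hx hx'; apply: goodP; apply: hP.
apply: NNPP => /not_ex_all_not hP.
have [l hl] : exists l : nat -> nat -> A, forall n,
    [/\ X (l n), agree n (shiftn S (l n)) z & ~ good (l n)].
  have h n : exists x, [/\ X x, agree n (shiftn S x) z & ~ good x].
    have /not_all_ex_not [x hx] := hP n; exists x.
    by split; [| |move=> hg]; apply: NNPP => h; apply: hx => *.
  exists (fun n => proj1_sig (constructive_indefinite_description _ (h n))) => n.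
  exact: (proj2_sig (constructive_indefinite_description _ (h n))).
have [|g hg] := @cluster_point _ (enum A) l; first by move=> m i; rewrite mem_enum.
have Xg : X g by apply: X_closure hg => n; have [] := hl n.
have gz : shiftn S g = z.
  apply: agree_ext => n; have [m [hm hm']] := hg (S + n) n.
  apply: agree_trans (agree_sym (agree_shiftn hm')) _.
  by have [_ h _] := hl m; apply: agree_leq h.
have [m [_ hm]] := hg S 0; have [_ _ []] := hl m.
have e : shiftn S (shiftn (elen f g S - S) (ext f g)) = shiftn S z.
  by rewrite -shiftnD subnK // -ext_shiftn // gz.
rewrite /good (elen_agree f hm).
have hag : agree S (shiftn (elen f g S - S) (ext f (l m)))
    (shiftn (elen f g S - S) (ext f g)).
  apply: agree_shiftn; rewrite subnK // -(elen_agree f hm); exact: ext_agree.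
apply: agree_trans hag _.
(* The limit point and [z] both reach [ext f z] after [S] steps. If they differed, [z] would return
   to itself after [j > 0] steps, against aperiodicity. *)
case: (shiftn_eq_branch _ Xz e) => [|->//|[j [hj _ h]]].
  by apply: (am_shiftn am); apply: X_ext.
by have := am_aperiodic am Xz h; lia.
Qed.

End Delay.

End BranchPoint.

(** * Tower partitions *)

Lemma ex_least (Q : nat -> Prop) :
  (exists n, Q n) -> exists n, Q n /\ forall m, m < n -> ~ Q m.
Proof.
move=> [n]; elim/ltn_ind: n => n IH hn.
case: (classic (exists2 m, m < n & Q m)) => [[m hm /(IH m hm)//]|h].
by exists n; split=> // m hm hQ; apply: h; exists m.
Qed.

(** The labels are the words of length [D] that begin some point of [C]; keeping only these makes
    every label attained. The point [y0] supplies a default for the other words. *)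
Lemma finite_labels (A : finType) (C : (nat -> A) -> Prop) (D : nat) y0 : C y0 ->
  exists (V : finType) (label : (nat -> A) -> V),
    (forall y y', C y -> C y' -> label y = label y' <-> agree D y y') /\
    forall v, exists c, C c /\ label c = v.
Proof.
move=> hy0.
pose ok (t : D.-tuple A) : bool :=
  if excluded_middle_informative (exists c, C c /\ mkseq c D = t)
  then true else false.
have okP (t : D.-tuple A) : reflect (exists c, C c /\ mkseq c D = t) (ok t).
  by rewrite /ok; case: excluded_middle_informative => h; constructor.
have hs (y : nat -> A) : size (mkseq y D) == D by rewrite size_mkseq.
pose wd y : D.-tuple A := Tuple (hs y).
have okw y : C y -> ok (wd y) by move=> hy; apply/okP; exists y.
pose V : finType := {t : D.-tuple A | ok t}.
pose label y : V := insubd (exist _ (wd y0) (okw _ hy0) : V) (wd y).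
have lv y : C y -> val (label y) = wd y by move=> hy; rewrite val_insubd okw.
exists V, label; split=> [y y' hy hy'|v].
  rewrite agree_mkseq; split=> [/(congr1 val)|e].
    by rewrite !lv // => /(congr1 val).
  by apply: val_inj; rewrite !lv //; apply: val_inj.
have [c [hc e]] := elimT (okP (val v)) (valP v); exists c; split=> //.
by apply: val_inj; rewrite lv //; apply: val_inj.
Qed.

Section Tower.
Variables (A : finType) (X : (nat -> A) -> Prop) (z : nat -> A).
Hypotheses (am : aperiodic_minimal X) (z_branch : branch_point X z)
  (z_uniq : forall z', branch_point X z' -> z' = z).
Variables (f : A -> seq A) (P : nat) (T : (nat -> A) -> nat -> A).
Hypotheses (f_size : forall a, 1 < size (f a)) (P_gt0 : 0 < P).

Definition base_set y := X y /\ agree P y z.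
Local Notation C := base_set.
Local Notation E := (elen f).

Hypotheses (T_C : forall y, C y -> C (T y)) (T_z : T z = z)
  (T_shiftn : forall q y, C y -> C (shiftn q y) ->
     T (shiftn q y) = shiftn (E y q) (T y))
  (T_recog : forall i y y', X y -> X y' -> shiftn i (T y) = T y' ->
     exists q, i = E y q /\ y' = shiftn q y)
  (T_agree : forall n y y', agree n y y' -> agree (E y n) (T y) (T y')).

(** [N] bounds the return time to the base and [D] is the length of the words that serve as labels.
    [D >= N + P] lets such a word determine the return time; [D >= 2N] compensates the letters lost
    while a tower is climbed. *)
Variables N D : nat.
Hypotheses (N_return : forall x, X x -> exists j, j < N /\ C (shiftn j x))
  (D_large : N + N + P <= D).

Let Cz : C z. Proof. by split=> //; case: z_branch. Qed.
Let C_X y : C y -> X y. Proof. by case. Qed.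

Lemma base_set_agree y y' : X y' -> agree P y y' -> C y -> C y'.
Proof.
by move=> hX h [_ hz]; split=> //; apply: agree_trans (agree_sym h) hz.
Qed.

Lemma elen_double y n : n + n <= E y n.
Proof. by have := elen_lower y n f_size; rewrite mulSn mul1n. Qed.

Lemma T_agree_double n y y' : agree n y y' -> agree (n + n) (T y) (T y').
Proof. by move=> /T_agree; apply: agree_leq; apply: elen_double. Qed.

Lemma iter_T_C n y : C y -> C (iter n T y).
Proof. by move=> hy; elim: n => //= n; apply: T_C. Qed.

(** [T] fixes [z] and doubles the length of an agreement, so each application gains at least one
    letter because [P] is positive. *)
Lemma iter_T_agree n y : C y -> agree (P + n) (iter n T y) z.
Proof.
move=> hy; elim: n => [|n IH]; first by rewrite addn0; case: hy.
have := T_agree_double IH; rewrite T_z; apply: agree_leq; lia.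
Qed.

Lemma iter_T_inter y : (forall n, exists c, C c /\ y = iter n T c) -> y = z.
Proof.
move=> h; apply: agree_ext => n; have [c [hc ->]] := h n.
by apply: agree_leq (@iter_T_agree n c hc); lia.
Qed.

(** * First returns to the base and disjointness of the tower floors *)

Definition is_return y q := 0 < q /\ C (shiftn q y).

Definition ret y : nat :=
  epsilon (inhabits 0)
    (fun q => is_return y q /\ forall j, j < q -> ~ is_return y j).

Lemma retP y : X y -> is_return y (ret y) /\ forall j, j < ret y -> ~ is_return y j.
Proof.
move=> hy; apply: (epsilon_spec (inhabits 0)
  (fun q => is_return y q /\ forall j, j < q -> ~ is_return y j)).
apply: ex_least; have [j [_ hj]] := N_return (am_shiftn am 1 hy).
by exists (1 + j); split=> //; rewrite shiftnD.
Qed.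

Lemma ret_leq y : X y -> ret y <= N.
Proof.
move=> hy; have [j [hj hC]] := N_return (am_shiftn am 1 hy).
rewrite leqNgt; apply/negP => hN; have [_ h] := retP hy.
by apply: (h (1 + j)); [lia|split=> //; rewrite shiftnD].
Qed.

Lemma ret_gt0 y : X y -> 0 < ret y.
Proof. by move=> /retP [[]]. Qed.

Lemma ret_C y : X y -> C (shiftn (ret y) y).
Proof. by move=> /retP [[]]. Qed.

Lemma ret_min y j : X y -> C (shiftn j y) -> j < ret y -> j = 0.
Proof.
move=> hy hC hj; case: (posnP j) => // j0; have [_ h] := retP hy.
by case: (h j hj).
Qed.

Lemma ret_agree y y' : X y -> X y' -> agree D y y' -> ret y = ret y'.
Proof.
move=> hy hy' h.
have half x x' : X x -> X x' -> agree D x x' -> ret x' <= ret x.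
  move=> hx hx' hxx; rewrite leqNgt; apply/negP => hlt; have [_ hm] := retP hx'.
  apply: (hm _ hlt); split; first exact: ret_gt0.
  apply: base_set_agree (ret_C hx); first exact: (am_shiftn am).
  by apply: agree_shiftn; apply: agree_leq hxx; have := ret_leq hx; lia.
by apply/eqP; rewrite eqn_leq !half //; apply: agree_sym.
Qed.

(** If the two pasts are equal once aligned, [k' - k] is a visit of [c'] to the base before its
    first return, hence zero. Otherwise they merge at [z] strictly inside the tower over [c], which
    is impossible as [z] lies in the base. *)
Lemma tower_unique k k' c c' : C c -> C c' -> k < ret c -> k' < ret c' ->
  shiftn k c = shiftn k' c' -> k = k' /\ c = c'.
Proof.
wlog hle : k k' c c' / k <= k' => [h hc hc' hk hk' e|hc hc' hk hk' e].
  case: (leqP k k') => [|/ltnW] hle; first exact: h.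
  by have [-> ->] := h _ _ _ _ hle hc' hc hk' hk (esym e).
have e' : shiftn k c = shiftn k (shiftn (k' - k) c') by rewrite -shiftnD subnK.
case: (shiftn_eq_branch am z_uniq (C_X hc) (am_shiftn am _ (C_X hc')) e').
  move=> h; have h0 : k' - k = 0.
    by apply: (ret_min (C_X hc')); rewrite -?h //; lia.
  by rewrite h h0; split=> //; lia.
move=> [j [hj h _]].
by have := @ret_min c j (C_X hc); rewrite h => /(_ Cz); lia.
Qed.

(* If the two pasts merged after leaving the base, they would merge at
   z = T z, strictly inside the tower over d, against recognizability. *)
Lemma image_tower_unique k k' d d' : C d -> C d' ->
  k < E d (ret d) -> k' < E d' (ret d') ->
  shiftn k (T d) = shiftn k' (T d') -> k = k' /\ d = d'.
Proof.
wlog hle : k k' d d' / k <= k' => [h hc hc' hk hk' e|hc hc' hk hk' e].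
  case: (leqP k k') => [|/ltnW] hle; first exact: h.
  by have [-> ->] := h _ _ _ _ hle hc' hc hk' hk (esym e).
have cut c i q y : C c -> C y -> i < E c (ret c) ->
    i = E c q -> y = shiftn q c -> q = 0.
  move=> Cc Cy hi ei ey; apply: (ret_min (C_X Cc)); first by rewrite -ey.
  by rewrite ltnNge; apply/negP => /(elen_mono f c); lia.
have e' : shiftn k (T d) = shiftn k (shiftn (k' - k) (T d')).
  by rewrite -shiftnD subnK.
case: (shiftn_eq_branch am z_uniq (C_X (T_C hc))
  (am_shiftn am _ (C_X (T_C hc'))) e').
  move=> h; have [q [e1 e2]] := T_recog (C_X hc') (C_X hc) (esym h).
  have q0 : q = 0 by apply: (cut d' (k' - k) q d) => //; lia.
  by rewrite q0 in e1 e2; rewrite e2 /=; split=> //; move: e1; rewrite elen0; lia.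
move=> [j [hj h _]]; rewrite -T_z in h.
have [q [e1 e2]] := T_recog (C_X hc) (C_X Cz) h.
have q0 : q = 0 by apply: (cut d j q z) => //; lia.
by rewrite q0 elen0 in e1; lia.
Qed.

(** The contraction behind the convergence of the coding. The image of the part before the first
    return covers the shift by [k] and one letter more; the remaining [D + n - ret c] letters are
    doubled, which gives at least [D + n] since [D >= 2N]. *)
Lemma T_agree_shiftn n k c c' : C c -> k < E c (ret c) -> agree (D + n) c c' ->
  agree (D + n.+1) (shiftn k (T c)) (shiftn k (T c')).
Proof.
move=> hc hk h; apply: agree_shiftn; apply: agree_leq (T_agree h).
have hr := ret_leq (C_X hc).
have -> : D + n = ret c + (D + n - ret c) by lia.
rewrite elenD; have := elen_double (shiftn (ret c) c) (D + n - ret c); lia.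
Qed.

(** * Labels, itineraries and the induced substitution *)

Variables (V : finType) (label : (nat -> A) -> V).
Hypotheses
  (label_agree : forall y y', C y -> C y' -> label y = label y' <-> agree D y y')
  (label_onto : forall v, exists c, C c /\ label c = v).

Definition pt v := proj1_sig (constructive_indefinite_description _ (label_onto v)).

Lemma pt_C v : C (pt v).
Proof. by rewrite /pt; case: constructive_indefinite_description => c []. Qed.

Lemma label_pt v : label (pt v) = v.
Proof. by rewrite /pt; case: constructive_indefinite_description => c []. Qed.

Definition height v := ret (pt v).

Lemma height_label y : C y -> height (label y) = ret y.
Proof.
move=> hy; have hp := pt_C (label y); apply: ret_agree; try exact: C_X.
by apply/label_agree => //; rewrite label_pt.
Qed.

Lemma height_gt0 v : 0 < height v.
Proof. exact: ret_gt0 (C_X (pt_C v)). Qed.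

Lemma height_leq v : height v <= N.
Proof. exact: ret_leq (C_X (pt_C v)). Qed.

Definition heights (W : seq V) := sumn (map height W).

Lemma heights_cons v W : heights (v :: W) = height v + heights W.
Proof. by []. Qed.

Lemma heights_cat W1 W2 : heights (W1 ++ W2) = heights W1 + heights W2.
Proof. by rewrite /heights map_cat sumn_cat. Qed.

Lemma heights_take_lt W i j : i < j -> j <= size W ->
  heights (take i W) < heights (take j W).
Proof.
elim: W i j => [|v W IH] i [|j] //=.
case: i => [|i] hij hj; first by rewrite /heights /= ltn_addr ?height_gt0.
by rewrite /heights /= ltn_add2l; apply: IH.
Qed.

(** The itinerary of [y] through the towers. The empty word still requires [C y], so that an
    itinerary ends in the base and can be continued there. *)
Fixpoint spell y (W : seq V) : Prop :=
  if W is v :: W'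
  then [/\ C y, label y = v & spell (shiftn (height v) y) W'] else C y.

Lemma spell_C y W : spell y W -> C y.
Proof. by case: W => [|v W] //= []. Qed.

Lemma spell_cat y W1 W2 :
  spell y (W1 ++ W2) <-> spell y W1 /\ spell (shiftn (heights W1) y) W2.
Proof.
elim: W1 y => [|v W1 IH] y /=.
  by split=> [h|[]//]; split=> //; apply: spell_C h.
rewrite /heights /= -/(heights W1) shiftnD.
by split=> [[h1 h2 /IH[]]|[[h1 h2 h3] h4]] //; split=> //; apply/IH.
Qed.

Lemma spell_nth v0 y W i : spell y W -> i < size W ->
  C (shiftn (heights (take i W)) y) /\
  label (shiftn (heights (take i W)) y) = nth v0 W i.
Proof.
move=> + hi; rewrite -{1}(cat_take_drop i W) spell_cat (drop_nth v0 hi) /=.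
by move=> [_ []].
Qed.

Lemma spell_exists m y : C y -> C (shiftn m y) ->
  exists W, spell y W /\ heights W = m.
Proof.
elim/ltn_ind: m y => m IH y hy hm; case: (posnP m) => [->|m0]; first by exists [::].
have hX := C_X hy; have hr : ret y <= m.
  by rewrite leqNgt; apply/negP => /(ret_min hX hm); lia.
have r0 := ret_gt0 hX.
have [||W [h1 h2]] := IH (m - ret y) _ (shiftn (ret y) y) (ret_C hX).
- by lia.
- by rewrite -shiftnD subnKC.
exists (label y :: W); rewrite /= /heights /= -/(heights W) h2 height_label //.
by split=> //; lia.
Qed.

Lemma spell_agree y y' W : X y' -> agree (heights W + D) y y' ->
  spell y W -> spell y' W.
Proof.
elim: W y y' => [|v W IH] y y' hX h /=.
  by apply: base_set_agree => //; apply: agree_leq h; lia.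
move=> [hy hl hs]; have hy' : C y'.
  by apply: base_set_agree hy => //; apply: agree_leq h; lia.
split=> //.
  by rewrite -hl; symmetry; apply/label_agree => //; apply: agree_leq h; lia.
apply: IH hs; first exact: (am_shiftn am).
by apply: agree_shiftn; rewrite addnA.
Qed.

(** Tower heights are first return times, so a visit to the base before the end of [W] can only
    occur at the bottom of one of its towers. *)
Lemma spell_mem y W j : spell y W -> j < heights W -> C (shiftn j y) ->
  label (shiftn j y) \in W.
Proof.
elim: W y j => [|v W IH] y j //=; rewrite {1}/heights /= -/(heights W).
move=> [hy hl hs] hj hC; rewrite inE; case: (ltnP j (height v)) => hjv.
  have -> : j = 0 by apply: (ret_min (C_X hy) hC); rewrite -height_label // hl.
  by rewrite -[shiftn 0 y]/y hl eqxx.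
have e : shiftn j y = shiftn (j - height v) (shiftn (height v) y).
  by rewrite -shiftnD subnKC.
by rewrite e IH ?orbT // -?e //; lia.
Qed.

(* As f at least doubles lengths and D >= 2N, the first D letters of c
   determine T c up to D letters beyond the end of the tower over c; this
   makes D-words usable as vertices, in place of return words to C. *)
Lemma theta_exists v : exists W, forall c, C c -> label c = v ->
  spell (T c) W /\ heights W = E c (ret c).
Proof.
have hp := pt_C v; have hX := C_X hp.
have [|W [h1 h2]] := @spell_exists (E (pt v) (height v)) (T (pt v)) (T_C hp).
  by rewrite -T_shiftn //; [apply: T_C|]; apply: ret_C.
exists W => c hc hl; have hag : agree D (pt v) c.
  by apply/label_agree => //; rewrite label_pt.
have er := ret_agree hX (C_X hc) hag; rewrite -/(height v) in er.
have hN := height_leq v.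
have eE : E c (ret c) = E (pt v) (height v).
  by rewrite -er; symmetry; apply: elen_agree; apply: agree_leq hag; lia.
split; last by rewrite eE.
apply: spell_agree h1; first exact: C_X (T_C hc).
apply: agree_leq (T_agree hag); rewrite h2.
have -> : D = height v + (D - height v) by lia.
rewrite elenD.
by have := elen_double (shiftn (height v) (pt v)) (D - height v); lia.
Qed.

Definition theta v : seq V :=
  proj1_sig (constructive_indefinite_description _ (theta_exists v)).

Lemma thetaP c : C c -> spell (T c) (theta (label c)) /\
  heights (theta (label c)) = E c (ret c).
Proof.
rewrite /theta; case: constructive_indefinite_description => W /= h hc.
exact: h.
Qed.

Lemma heights_theta v : heights (theta v) = E (pt v) (height v).
Proof. by have [_] := thetaP (pt_C v); rewrite label_pt. Qed.

Lemma theta_neq0 v : theta v != [::].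
Proof.
apply/eqP => e; have := heights_theta v; rewrite e /heights /=.
by have := elen_double (pt v) (height v); have := height_gt0 v; lia.
Qed.

Lemma head_theta v0 c : C c -> head v0 (theta (label c)) = label (T c).
Proof.
move=> /thetaP [+ _]; have := theta_neq0 (label c).
by case: (theta _) => //= w W _ [].
Qed.

(** [theta] is the action of [T] on itineraries. The pieces fit together because [T_shiftn] sends a
    return to the base to the end of the image of the tower just climbed. *)
Lemma spell_T y W : spell y W ->
  spell (T y) (tauw theta W) /\ heights (tauw theta W) = E y (heights W).
Proof.
elim: W y => [|v W IH] y /=; first by move=> hy; split; [apply: T_C|].
move=> [hy hl hs]; have [h1 h2] := thetaP hy; have [h3 h4] := IH _ hs.
rewrite -height_label // hl in h1 h2.
rewrite /tauw /= -/(tauw theta W) heights_cons heights_cat elenD h2 h4.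
split=> //; apply/spell_cat; split=> //.
by rewrite h2 -T_shiftn //; apply: spell_C hs.
Qed.

Lemma spell_iter_T k c : C c -> spell (iter k T c) (iterw theta k [:: label c]) /\
  k < heights (iterw theta k [:: label c]).
Proof.
move=> hc; elim: k => [|k [h1 h2]] /=.
  split; last by rewrite /heights /= addn0 height_gt0.
  by split=> //; rewrite height_label //; apply/ret_C/C_X.
have [h3 h4] := spell_T h1; split=> //.
rewrite h4.
have := elen_double (iter k T c) (heights (iterw theta k [:: label c])); lia.
Qed.

(** By minimality the word of each label [b] occurs in [z] at a position at most [J]. After
    [J + D + 1] applications of [T] any base point agrees with [z] beyond that occurrence, and its
    itinerary, an iterated image under [theta], is long enough to reach it. *)
Lemma theta_primitive : primitive theta.
Proof.
have hb b : exists j, agree D (shiftn j z) (pt b).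
  have [_ /(_ _ (C_X Cz)) [j [_ hj]]] := am_minimal am D (C_X (pt_C b)).
  by exists j.
pose j b := proj1_sig (constructive_indefinite_description _ (hb b)).
have hj b : agree D (shiftn (j b) z) (pt b).
  exact: (proj2_sig (constructive_indefinite_description _ (hb b))).
pose J := \max_b j b.
exists (J + D).+1; split=> // a b.
rewrite incpow_gt0; have hp := pt_C a.
have [h1 h2] := spell_iter_T (J + D).+1 hp; rewrite label_pt in h1 h2.
have hJ : j b <= J by exact: leq_bigmax.
have hag : agree D (shiftn (j b) (iter (J + D).+1 T (pt a))) (pt b).
  apply: agree_trans (hj b); apply: agree_shiftn.
  by apply: agree_leq (@iter_T_agree (J + D).+1 _ hp); lia.
have hC : C (shiftn (j b) (iter (J + D).+1 T (pt a))).
  apply: base_set_agree (pt_C b).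
    by apply/(am_shiftn am)/C_X/iter_T_C.
  by apply/agree_sym; apply: agree_leq hag; lia.
rewrite -(label_pt b); move/(label_agree hC (pt_C b)): hag => <-.
by apply: spell_mem h1 _ hC; lia.
Qed.

(** * The stationary diagram and its path space *)

Definition diagram : sbd := @SBD V theta height.
Local Notation path := (nat -> V * nat).

(* A tail is a path whose first edge matters only through its range (Q 0).1;
   base_point Q is the point of C at the bottom of the tower that a path
   with this tail climbs at level 0. *)
Definition is_tail (Q : path) := forall j,
  (Q j.+1).2 < size (theta (Q j.+1).1) /\ @esrc diagram (Q j.+1) = (Q j).1.

(** The height at which the source tower of [e] starts inside the image of the tower over its
    range. *)
Definition offset (e : V * nat) := heights (take e.2 (theta e.1)).

(** Follows the tail up to level [n], where the representative of the vertex stands in for the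
    unknown point; the choice disappears in the limit. *)
Fixpoint base_approx n (Q : path) : nat -> A :=
  if n is n'.+1 then shiftn (offset (Q 1)) (T (base_approx n' (shiftn 1 Q)))
  else pt (Q 0).1.

Definition base_point (Q : path) : nat -> A := fun i => base_approx i Q i.

Definition path_point (x : path) : nat -> A := shiftn (x 0).2 (base_point x).

Lemma is_tail_shiftn Q : is_tail Q -> is_tail (shiftn 1 Q).
Proof. by move=> h j; apply: h. Qed.

Lemma is_tail_path x : XB (B := diagram) x -> is_tail x.
Proof. by move=> h j; have [_ h2] := h j; have [h1 _] := h j.+1. Qed.

Lemma offset_lt e c : C c -> label c = e.1 -> e.2 < size (theta e.1) ->
  offset e < E c (ret c).
Proof.
move=> hc hl he; have [_ <-] := thetaP hc; rewrite hl /offset.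
by rewrite -[X in _ < heights X](take_size (theta e.1)); apply: heights_take_lt.
Qed.

Lemma offset_image e c : C c -> label c = e.1 -> e.2 < size (theta e.1) ->
  C (shiftn (offset e) (T c)) /\ label (shiftn (offset e) (T c)) = @esrc diagram e.
Proof.
by move=> hc hl he; apply: spell_nth => //; rewrite -hl; have [] := thetaP hc.
Qed.

Lemma base_approx_C n Q : is_tail Q ->
  C (base_approx n Q) /\ label (base_approx n Q) = (Q 0).1.
Proof.
elim: n Q => [|n IH] Q hQ /=; first by split; [apply: pt_C|apply: label_pt].
have [h1 h2] := IH _ (is_tail_shiftn hQ); have [h3 h4] := hQ 0.
by rewrite -h4; apply: offset_image.
Qed.

(** At the last level the two points have the same label, hence share [D] letters; every level
    descended adds one. *)
Lemma base_approx_agreeS n Q : is_tail Q ->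
  agree (D + n) (base_approx n Q) (base_approx n.+1 Q).
Proof.
elim: n Q => [|n IH] Q hQ.
  have [h1 h2] := base_approx_C 0 hQ; have [h3 h4] := base_approx_C 1 hQ.
  by rewrite addn0; apply/label_agree => //; rewrite h2 h4.
have hQ' := is_tail_shiftn hQ; have [h1 h2] := base_approx_C n hQ'.
have [h3 h4] := hQ 0.
by apply: T_agree_shiftn (IH _ hQ') => //; apply: offset_lt.
Qed.

Lemma base_approx_agree m n Q : is_tail Q -> n <= m ->
  agree (D + n) (base_approx n Q) (base_approx m Q).
Proof.
move=> hQ /subnKC <-; elim: (m - n) => [|k IH]; first by rewrite addn0.
apply: agree_trans IH _; rewrite addnS.
by apply: agree_leq (base_approx_agreeS hQ); lia.
Qed.

Lemma base_point_agree n Q : is_tail Q ->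
  agree (D + n) (base_approx n Q) (base_point Q).
Proof.
move=> hQ i hi; rewrite /base_point; case: (leqP n i) => h.
  exact: base_approx_agree hi.
by symmetry; apply: (base_approx_agree hQ (ltnW h)); lia.
Qed.

Lemma base_point_X Q : is_tail Q -> X (base_point Q).
Proof.
move=> hQ; apply: (am_closed am) => n; exists (base_approx n Q); split.
  by have [[]] := base_approx_C n hQ.
by apply/agree_sym; apply: agree_leq (base_point_agree (n := n) hQ); lia.
Qed.

Lemma base_point_C Q : is_tail Q ->
  C (base_point Q) /\ label (base_point Q) = (Q 0).1.
Proof.
move=> hQ; have [h1 h2] := base_approx_C 0 hQ.
have := base_point_agree (n := 0) hQ; rewrite addn0 => h.
have hC : C (base_point Q).
  by apply: base_set_agree h1; [apply: base_point_X|apply: agree_leq h; lia].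
by split=> //; rewrite -h2; symmetry; apply/label_agree.
Qed.

Lemma base_pointE Q : is_tail Q ->
  base_point Q = shiftn (offset (Q 1)) (T (base_point (shiftn 1 Q))).
Proof.
move=> hQ; apply: agree_ext => n; have hQ' := is_tail_shiftn hQ.
have [h1 h2] := base_approx_C n hQ'; have [h3 h4] := hQ 0.
apply: (@agree_leq _ _ (D + n.+1)); first by lia.
apply: agree_trans (agree_sym (base_point_agree hQ)) _.
by apply: T_agree_shiftn (base_point_agree hQ') => //; apply: offset_lt.
Qed.

Lemma base_approx_ext n Q R : (Q 0).1 = (R 0).1 ->
  (forall i, 0 < i <= n -> Q i = R i) -> base_approx n Q = base_approx n R.
Proof.
elim: n Q R => [|n IH] Q R h0 h /=; first by rewrite h0.
rewrite h //; congr (shiftn _ (T _)); apply: IH => [|i hi].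
  by rewrite /shiftn h.
by rewrite /shiftn h //; lia.
Qed.

Lemma base_point_ext Q R : (Q 0).1 = (R 0).1 ->
  (forall i, 0 < i -> Q i = R i) -> base_point Q = base_point R.
Proof.
move=> h0 h; apply: functional_extensionality => n; rewrite /base_point.
by rewrite (base_approx_ext h0) // => i /andP[/h].
Qed.

Lemma path_point_X x : XB (B := diagram) x -> X (path_point x).
Proof. by move=> /is_tail_path /base_point_X; apply: am_shiftn. Qed.

Lemma path_point_cont : cont_on (XB (B := diagram)) path_point.
Proof.
move=> x hx n; exists ((x 0).2 + n).+1 => y hy h i hi.
rewrite /path_point /shiftn h // /base_point (@base_approx_ext _ y x) ?h //.
move=> j /andP[_ hj]; apply: h; apply: (leq_ltn_trans hj).
exact: (leq_add (leqnn (x 0).2) (ltnW hi)).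
Qed.

(** [image_tower_unique] recovers the offset of the first relevant edge and the base point one level
    up. The latter's label is the range of the edge, and partial heights increase strictly, so the
    offset fixes its rank. *)
Lemma base_point_inj Q R : is_tail Q -> is_tail R -> base_point Q = base_point R ->
  (Q 0).1 = (R 0).1 /\ forall j, 0 < j -> Q j = R j.
Proof.
move=> hQ hR e.
have key Q' R' : is_tail Q' -> is_tail R' -> base_point Q' = base_point R' ->
    Q' 1 = R' 1 /\ base_point (shiftn 1 Q') = base_point (shiftn 1 R').
  move=> hQ' hR' e'; rewrite (base_pointE hQ') (base_pointE hR') in e'.
  have [c1 l1] := base_point_C (is_tail_shiftn hQ').
  have [c2 l2] := base_point_C (is_tail_shiftn hR').
  have [s1 _] := hQ' 0; have [s2 _] := hR' 0.
  have [eo eb] := image_tower_unique c1 c2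
    (offset_lt c1 l1 s1) (offset_lt c2 l2 s2) e'.
  split=> //; have ev : (Q' 1).1 = (R' 1).1.
    by rewrite -[(Q' 1)]/(shiftn 1 Q' 0) -[(R' 1)]/(shiftn 1 R' 0) -l1 -l2 eb.
  move: s1 s2 (eo : offset (Q' 1) = offset (R' 1)) ev => {eo}.
  rewrite /offset; case: (Q' 1) (R' 1) => [v i] [w j] /= + + + ew.
  rewrite ew; case: (ltngtP i j) => [h _ hj eo|h hi _ eo|-> //].
    by have := heights_take_lt h (ltnW hj); rewrite eo ltnn.
  by have := heights_take_lt h (ltnW hi); rewrite eo ltnn.
split.
  by have [_ <-] := base_point_C hQ; have [_ <-] := base_point_C hR; rewrite e.
move=> [//|j] _; elim: j Q R hQ hR e => [|j IH] Q R hQ hR e.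
  by have [] := key _ _ hQ hR e.
have [_ h] := key _ _ hQ hR e.
exact: IH (is_tail_shiftn hQ) (is_tail_shiftn hR) h.
Qed.

Lemma path_point_inj x y : XB (B := diagram) x -> XB (B := diagram) y ->
  path_point x = path_point y -> x = y.
Proof.
move=> hx hy e; have tx := is_tail_path hx; have ty := is_tail_path hy.
have [c1 l1] := base_point_C tx; have [c2 l2] := base_point_C ty.
have b1 : (x 0).2 < ret (base_point x).
  by rewrite -height_label // l1; have [] := hx 0.
have b2 : (y 0).2 < ret (base_point y).
  by rewrite -height_label // l2; have [] := hy 0.
have [e2 eb] := tower_unique c1 c2 b1 b2 e.
have [e1 h] := base_point_inj tx ty eb.
apply: functional_extensionality => -[|j]; last exact: h.
by rewrite [x 0]surjective_pairing e1 e2 -surjective_pairing.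
Qed.

(** The carry of an odometer: leaving the last small tower in the image of a large one amounts to
    leaving the large one. *)
Lemma base_point_carry Q : is_tail Q -> (Q 1).2.+1 = size (theta (Q 1).1) ->
  shiftn (height (Q 0).1) (base_point Q) =
  T (shiftn (height (Q 1).1) (base_point (shiftn 1 Q))).
Proof.
move=> hQ hm; have [h3 h4] := hQ 0.
have [c1 l1] := base_point_C (is_tail_shiftn hQ).
have l1' : label (base_point (shiftn 1 Q)) = (Q 1).1 by [].
rewrite (base_pointE hQ) -shiftnD -l1' height_label // T_shiftn //; last first.
  exact/ret_C/C_X.
have [_ <-] := thetaP c1; rewrite l1'.
suff -> : offset (Q 1) + height (Q 0).1 = heights (theta (Q 1).1) by [].
rewrite -h4 /esrc /offset /= -[in RHS](take_size (theta (Q 1).1)) -hm.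
by rewrite (take_nth (Q 1).1) // -cats1 heights_cat heights_cons addn0.
Qed.

(** Carries through the [k] maximal edges, then passes to the next tower in the same image at index
    [k.+1]. *)
Lemma base_point_succ k Q R : is_tail Q -> is_tail R ->
  (forall j, 0 < j <= k -> (Q j).2.+1 = size (theta (Q j).1) /\ (R j).2 = 0) ->
  R k.+1 = ((Q k.+1).1, (Q k.+1).2.+1) -> (forall j, k.+1 < j -> R j = Q j) ->
  base_point R = shiftn (height (Q 0).1) (base_point Q).
Proof.
elim: k Q R => [|k IH] Q R hQ hR hlt hk hgt.
  have [q1 q2] := hQ 0; have [r1 r2] := hR 0.
  rewrite (base_pointE hR) (base_pointE hQ) -shiftnD hk.
  have -> : base_point (shiftn 1 R) = base_point (shiftn 1 Q).
    by apply: base_point_ext => [|i hi]; rewrite /shiftn ?hk // hgt.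
  suff -> : offset ((Q 1).1, (Q 1).2.+1) = offset (Q 1) + height (Q 0).1 by [].
  rewrite /offset -q2 /esrc /=.
  by rewrite (take_nth (Q 1).1) // -cats1 heights_cat heights_cons addn0.
have [m1 r1] := hlt 1 isT.
rewrite base_point_carry // (base_pointE hR) /offset r1 take0.
suff -> : base_point (shiftn 1 R) =
    shiftn (height (Q 1).1) (base_point (shiftn 1 Q)) by [].
apply: (IH (shiftn 1 Q) (shiftn 1 R));
  [exact: is_tail_shiftn|exact: is_tail_shiftn| | |].
- by move=> j /andP[_ hj]; apply: (hlt j.+1).
- exact: hk.
- by move=> j hj; apply: (hgt j.+1).
Qed.

(** The carry never stops, so the point reached lies in every iterated image of the base under [T],
    and these meet only in [z]. *)
Lemma base_point_max Q : is_tail Q ->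
  (forall j, (Q j.+1).2.+1 = size (theta (Q j.+1).1)) ->
  shiftn (height (Q 0).1) (base_point Q) = z.
Proof.
move=> hQ hm; apply: iter_T_inter => n; elim: n Q hQ hm => [|n IH] Q hQ hm.
  exists (shiftn (height (Q 0).1) (base_point Q)); split=> //.
  have [c1 l1] := base_point_C hQ; rewrite -l1 height_label //; exact/ret_C/C_X.
have [c [hc e]] := IH _ (is_tail_shiftn hQ) (fun j => hm j.+1).
by exists c; split=> //=; rewrite -e base_point_carry.
Qed.

Lemma base_point_min Q : is_tail Q -> (forall j, (Q j.+1).2 = 0) ->
  base_point Q = z.
Proof.
move=> hQ hm; apply: iter_T_inter => n; elim: n Q hQ hm => [|n IH] Q hQ hm.
  by exists (base_point Q); split=> //; have [] := base_point_C hQ.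
have [c [hc e]] := IH _ (is_tail_shiftn hQ) (fun j => hm j.+1).
by exists c; split=> //=; rewrite -e base_pointE // /offset hm take0.
Qed.

(** The path is constant because [T] fixes [z]: the first letter of [theta (label z)] is [label z]
    again. *)
Definition min_path : path := fun=> (label z, 0).

Lemma min_path_exists : @is_min_path diagram min_path.
Proof.
split=> // -[|j]; split=> //=.
- exact: height_gt0.
- by rewrite /esrc /= nth0 head_theta // T_z.
- by rewrite lt0n size_eq0 theta_neq0.
- by rewrite /esrc /= nth0 head_theta // T_z.
Qed.

Lemma min_path_unique x : @is_min_path diagram x -> x = min_path.
Proof.
move=> [hx h0]; apply: path_point_inj => //; first by have [] := min_path_exists.
have [hm _] := min_path_exists.
rewrite /path_point h0 /= (base_point_min (is_tail_path hx)) //.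
by rewrite (base_point_min (is_tail_path hm)).
Qed.

Lemma diagram_wf : Bwf diagram.
Proof.
split; first by exists (label z).
split; first exact: height_gt0.
split; first exact: theta_neq0.
(* A positive entry of a power of the incidence matrix has a positive last factor, which gives a
   letter whose image contains [b]. *)
move=> b; have [[|k] [k0 hk]] := theta_primitive; first by [].
have := hk b b => /=; rewrite lt0n sum_nat_eq0 negb_forall => /existsP [c].
by rewrite muln_eq0 negb_or -!lt0n -has_count has_pred1 => /andP[_]; exists c.
Qed.

Lemma diagram_semi_proper : semi_proper diagram.
Proof.
split; first exact: theta_primitive.
by exists min_path; split; [exact: min_path_exists|exact: min_path_unique].
Qed.

(** * The Vershik map corresponds to the shift *)

Lemma vershik_max x : (forall k, ~~ @nonmax diagram k (x k)) ->
  @vershik diagram x = min_path.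
Proof.
move=> h; rewrite /vershik; case: excluded_middle_informative => [H|_].
  by exfalso; have [k hk] := H; have := h k; rewrite hk.
case: excluded_middle_informative => [H|[]]; last first.
  by exists min_path; apply: min_path_exists.
by case: constructive_indefinite_description => m hm /=; apply: min_path_unique.
Qed.

Lemma vershik_nonmax x : (exists k, @nonmax diagram k (x k)) ->
  exists k, [/\ @nonmax diagram k (x k),
      forall j, j < k -> ~~ @nonmax diagram j (x j)
    & @vershik diagram x = fun j =>
       if j < k then (iter (k.-1 - j) (fun c => head c (theta c))
                       (@esrc diagram ((x k).1, (x k).2.+1)), 0)
       else if j == k then ((x k).1, (x k).2.+1) else x j].
Proof.
rewrite /vershik; case: excluded_middle_informative => [H|//] _.
case: (ex_minnP H) => k hk hmin; exists k; split=> // j hj.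
by apply/negP => /hmin; lia.
Qed.

Lemma vershik_XB x : XB (B := diagram) x -> XB (B := diagram) (@vershik diagram x).
Proof.
move=> hx; case: (classic (exists k, @nonmax diagram k (x k)));
  [move=> /vershik_nonmax|move=> h]; last first.
  rewrite vershik_max; first by have [] := min_path_exists.
  by move=> k; apply/negP => hk; apply: h; exists k.
move=> [k [hk _ ->]] j; have hpos i v : 0 < @ebound diagram i v.
  by case: i => [|i] /=; [apply: height_gt0|rewrite lt0n size_eq0 theta_neq0].
have [h1 h2] := hx j.
case: (ltngtP j k) => hjk /=; last 1 first.
- have [-> ->] : (j.+1 < k) = false /\ (j.+1 == k) = false by lia.
  by rewrite hjk; split=> //; have [] := hx k.
- split; first exact: hpos.
  case: (ltngtP j.+1 k) => hjk'; last 1 first.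
  - by rewrite -hjk' /= subnn.
  - rewrite /esrc /= nth0; have -> : k.-1 - j = (k.-1 - j.+1).+1 by lia.
    by rewrite iterS; case: (theta _).
  - by lia.
- by have [-> ->] : (j.+1 < k) = false /\ (j.+1 == k) = false by lia.
Qed.

(** A maximal path codes a point whose shift is [z], the point coded by the minimal path. If the
    first edge is not maximal, only the floor changes; otherwise the first tower is left and
    [base_point_succ] applies. *)
Lemma path_point_vershik x : XB (B := diagram) x ->
  path_point (@vershik diagram x) = shift (path_point x).
Proof.
move=> hx; have tx := is_tail_path hx; have [b0 _] := hx 0.
have sh : shift (path_point x) = shiftn (x 0).2.+1 (base_point x).
  by rewrite -addn1 shiftnD.
case: (classic (exists k, @nonmax diagram k (x k))) => [h|h]; last first.
  have hmax k : ~~ @nonmax diagram k (x k) by apply/negP => hk; apply: h; exists k.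
  have [hm _] := min_path_exists.
  rewrite vershik_max // sh /path_point (base_point_min (is_tail_path hm)) //=.
  have -> : (x 0).2.+1 = height (x 0).1.
    by have := hmax 0; rewrite /nonmax -leqNgt => h0; apply/eqP; rewrite eqn_leq b0.
  rewrite base_point_max // => j; have [bj _] := hx j.+1.
  have := hmax j.+1; rewrite /nonmax -leqNgt => hj.
  by apply/eqP; rewrite eqn_leq bj.
have hv := is_tail_path (vershik_XB hx).
have [[|k] [hk hlt e]] := vershik_nonmax h.
  rewrite sh /path_point; have -> : base_point (@vershik diagram x) = base_point x.
    by apply: base_point_ext; rewrite e //= => -[].
  by rewrite e.
have -> : path_point (@vershik diagram x) = base_point (@vershik diagram x).
  by rewrite /path_point e.
have hmax j : j <= k -> (x j).2.+1 = @ebound diagram j (x j).1.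
  move=> hj; have [bj _] := hx j; have := hlt j hj.
  by rewrite /nonmax -leqNgt => hj'; apply/eqP; rewrite eqn_leq bj.
rewrite sh (hmax 0) //; apply: (base_point_succ (k := k) tx hv).
- move=> j /andP[j0 hj]; rewrite hmax // e ltnS hj; split=> //.
  by case: j j0 {hj}.
- by rewrite e ltnn eqxx.
- move=> j hj; rewrite e.
  by have [-> ->] : (j < k.+1) = false /\ (j == k.+1) = false by lia.
Qed.

(** * Surjectivity of the coding and continuity of its inverse *)

Lemma vershik_iter_XB n : XB (B := diagram) (iter n (@vershik diagram) min_path).
Proof.
by elim: n => [|n IH]; [have [] := min_path_exists|apply: vershik_XB].
Qed.

Lemma path_point_vershik_iter n :
  path_point (iter n (@vershik diagram) min_path) = shiftn n z.
Proof.
have [hm _] := min_path_exists.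
elim: n => [|n IH]; first by rewrite /path_point (base_point_min (is_tail_path hm)).
rewrite iterS path_point_vershik ?IH; last exact: vershik_iter_XB.
by rewrite -addn1 shiftnD.
Qed.

Lemma path_cluster (l : nat -> path) : (forall n, XB (B := diagram) (l n)) ->
  exists g, XB (B := diagram) g /\
    forall n M, exists m, M <= m /\ agree n (l m) g.
Proof.
(* [K] bounds the rank of an edge at all levels: by a height, at most [N], at the first, and by the
   length of a [theta]-image at the others. *)
move=> hl; pose K := \max_v (size (theta v)) + N.
pose edges := [seq (v, i) | v <- enum V, i <- iota 0 K].
case: (@cluster_point _ edges l).
  move=> m j; rewrite [l m j]surjective_pairing; apply/allpairsP.
  exists (l m j); rewrite mem_enum mem_iota; split=> //=.
  have [+ _] := hl m j; have := height_leq (l m j).1.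
  have := @leq_bigmax V (fun v => size (theta v)) (l m j).1.
  by case: j => [|j] /=; rewrite /K; lia.
move=> g hg; exists g; split=> // j.
have [m [_ h]] := hg j.+2 0.
by rewrite -!h //; apply: hl.
Qed.

(** The shifts of [z] are coded by the Vershik orbit of the minimal path and accumulate at [x]; by
    continuity a cluster point of their codes codes [x]. *)
Lemma path_point_onto x : X x -> exists y, XB (B := diagram) y /\ path_point y = x.
Proof.
move=> hx.
have hm n : exists m, agree n (shiftn m z) x.
  by have [_ /(_ z (C_X Cz)) [m [_ hm]]] := am_minimal am n hx; exists m.
pose m n := proj1_sig (constructive_indefinite_description _ (hm n)).
have hmz n : agree n (shiftn (m n) z) x.
  exact: (proj2_sig (constructive_indefinite_description _ (hm n))).
pose l n := iter (m n) (@vershik diagram) min_path.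
have hl n : XB (B := diagram) (l n) by apply: vershik_iter_XB.
have [g [Xg hg]] := path_cluster hl; exists g; split=> //.
apply: agree_ext => n; have [k hk] := path_point_cont Xg n.
have [i [hi hag]] := hg k n.
apply: agree_trans (agree_sym (hk _ (hl i) hag)) _.
by rewrite path_point_vershik_iter; apply: agree_leq (hmz i).
Qed.

Lemma diagram_conj : top_conj (XB (B := diagram)) (@vershik diagram) X shift.
Proof.
have [y0 _] : exists y0 : path, True by exists min_path.
pose g x :=
  epsilon (inhabits y0) (fun y => XB (B := diagram) y /\ path_point y = x).
have hg x : X x -> XB (B := diagram) (g x) /\ path_point (g x) = x.
  by move=> /path_point_onto h; apply: epsilon_spec h.
exists path_point, g; split; first exact: path_point_X.
split; first by move=> y /hg [].
split.
  move=> x hx; have [h1 h2] := hg _ (path_point_X hx); exact: path_point_inj.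
split; first by move=> y /hg [].
split; first exact: path_point_cont.
split; last exact: path_point_vershik.
(* If the inverse were discontinuous at [x], codes of points tending to [x] would stay away from
   [g x]; a cluster point of them would still code [x], against injectivity. *)
move=> x hx n; apply: NNPP => /not_ex_all_not hn.
have hy m : exists y, [/\ X y, agree m y x & ~ agree n (g y) (g x)].
  have /not_all_ex_not [y h] := hn m; exists y.
  split=> [||hag]; last by apply: h => _ _ i hi; apply: hag.
    by apply: NNPP => h'; apply: h => /h'.
  by apply: NNPP => h'; apply: h => _ /h'.
pose y m := proj1_sig (constructive_indefinite_description _ (hy m)).
have hyP m : [/\ X (y m), agree m (y m) x & ~ agree n (g (y m)) (g x)].
  exact: (proj2_sig (constructive_indefinite_description _ (hy m))).
have hl m : XB (B := diagram) (g (y m)) by have [/hg []] := hyP m.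
have [p [Xp hp]] := path_cluster hl.
have ep : p = g x.
  have [h1 h2] := hg x hx; apply: path_point_inj => //; rewrite h2.
  apply: agree_ext => k; have [k' hk'] := path_point_cont Xp k.
  have [i [hi hag]] := hp k' k; have [h3 h4 _] := hyP i.
  apply: agree_trans (agree_sym (hk' _ (hl i) hag)) _.
  by have [_ ->] := hg _ h3; apply: agree_leq h4.
by have [i [_ hag]] := hp n 0; have [_ _ []] := hyP i; rewrite -ep.
Qed.

Lemma diagram_exists : exists B : sbd,
  Bwf B /\ semi_proper B /\ top_conj (@XB B) (@vershik B) X shift.
Proof.
exists diagram; split; first exact: diagram_wf.
by split; [exact: diagram_semi_proper|exact: diagram_conj].
Qed.

End Tower.

(** Checks that the delayed substitution, on a cylinder around [z] small enough for pasts to be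
    unambiguous, satisfies the requirements of the tower construction. *)
Lemma stationary_model (A : finType) (X : (nat -> A) -> Prop) (f : A -> seq A) :
  aperiodic_minimal X -> quasi_invertible X -> (forall a, 1 < size (f a)) ->
  (forall y, X y -> X (ext f y)) -> recognizable X f ->
  exists B : sbd,
    Bwf B /\ semi_proper B /\ top_conj (@XB B) (@vershik B) X shift.
Proof.
move=> am [z [zb zu]] fs Xf Rf; have Xz := proj1 zb.
have f0 := size_neq0 fs.
have [S zS] := ext_branch_point am zb zu fs Xf Rf.
have [P0 hP0] := delay_of_past am zb zu fs Xf zS.
pose P := P0.+1; pose T := delay z f S.
have past x : X x -> base_set X z P (shiftn S x) ->
    shiftn (elen f x S - S) (ext f x) = T (shiftn S x).
  by move=> hx [_ h]; apply: hP0 => //; apply: agree_leq h.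
have T_z : T z = z by apply: delay_z.
have T_agree n y y' : agree n y y' -> agree (elen f y n) (T y) (T y').
  by move=> /(delay_agree z fs (S := S)); apply: agree_leq; apply: leq_addl.
have T_C y : base_set X z P y -> base_set X z P (T y).
  move=> hC; have [hy hz] := hC; split; last first.
    by rewrite -T_z; apply: agree_leq (T_agree _ _ _ hz); apply: elen_ge.
  (* With [x] a past of [y] of length [S], [T y] is a shift of [ext f x], which places it in [X]. *)
  have [x [hx ex]] := shiftn_onto am S hy; rewrite -ex in hC.
  by rewrite -ex -past //; apply: (am_shiftn am); apply: Xf.
have T_shiftn q y : base_set X z P y -> base_set X z P (shiftn q y) ->
    T (shiftn q y) = shiftn (elen f y q) (T y).
  (* A past [x] of [y] yields the past [shiftn q x] of [shiftn q y], so both values of [T] are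
     shifts of the same sequence [ext f x]; only the two shift lengths remain to be compared. *)
  move=> [hy hz]; have [x [hx ex]] := shiftn_onto am S hy.
  have e : shiftn q y = shiftn S (shiftn q x) by rewrite -ex -!shiftnD addnC.
  rewrite e => hC; rewrite -(past _ (am_shiftn am q hx) hC) -{2}ex.
  rewrite -past //; last first.
    by rewrite ex.
  rewrite ext_shiftn // -!shiftnD.
  suff -> : elen f x q + (elen f (shiftn q x) S - S) =
      elen f x S - S + elen f y q by [].
  have h1 := elenD f x q S; have h2 := elenD f x S q.
  rewrite ex addnC in h2; have h3 := elen_ge f0 x S.
  by have h4 := elen_ge f0 (shiftn q x) S; lia.
have [N hN] := am_minimal am P Xz.
have N_return x : X x -> exists j, j < N /\ base_set X z P (shiftn j x).
  move=> hx; have [j [hj h]] := hN x hx; exists j; split=> //.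
  by split=> //; apply: am_shiftn.
have [|V [label [hl ho]]] := @finite_labels A (base_set X z P) (N + N + P) z.
  by split.
by apply: (diagram_exists (z := z) (f := f) (T := T) am zb zu fs (ltn0Sn P0) T_C T_z
  T_shiftn _ T_agree N_return (leqnn _) hl ho); apply: delay_recog.
Qed.

Theorem theorem13 (A : finType) (tau : A -> seq A) (u : nat -> A) :
  (forall a, tau a != [::]) ->
  primitive tau ->
  infinite_set (Xtau u) ->
  unilaterally_recognizable tau u ->
  (forall k, injective (fun a : A => iterw tau k [:: a])) ->
  fixed_point tau u ->
  left_proper tau ->
  quasi_invertible (Xtau u) ->
  exists B : sbd,
    Bwf B /\ semi_proper B /\
    top_conj (@XB B) (@vershik B) (Xtau u) shift.
Proof.
move=> tau0 prim inf recog inj fixed _ qi.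
have tau_inj : injective tau.
  by move=> a b e; apply: (inj 1); rewrite /iterw /tauw /= e.
have am := Xtau_aperiodic_minimal tau0 prim inf fixed.
have [f [fs Xf Rf]] := Xtau_expanding_power tau0 prim inf recog tau_inj fixed.
exact: stationary_model am qi fs Xf Rf.
Qed.
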